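(* Let $A_1,\ldots,A_m\in\mathbb{M}_d$. Then $$\left|\sum_{k=1}^m A_k\right|\prec_{\mathrm{wlog}}\sqrt{2}\sum_{k=1}^m|A_k|_{\mathrm{qsym}}.$$
   Context: $d,m\ge 1$ are integers, $\mathbb{M}_d$ is the space of complex $d\times d$ matrices and $\mathbb{M}_d^+$ its cone of positive semidefinite matrices. For $A\in\mathbb{M}_d$, $|A|=(A^*A)^{1/2}$, so $|A^*|=(AA^* )^{1/2}$. The quadratic symmetric modulus of $A$ is $$|A|_{\mathrm{qsym}}:=\sqrt{\frac{|A|^2+|A^*|^2}{2}}\in\mathbb{M}_d^+.$$ For $A\in\mathbb{M}_d^+$, $\lambda_1^{\downarrow}(A)\ge\cdots\ge\lambda_d^{\downarrow}(A)$ are the eigenvalues of $A$ in nonincreasing order, with multiplicity. For $A,B\in\mathbb{M}_d^+$, the weak log-majorization $A\prec_{\mathrm{wlog}}B$ means $\prod_{j=1}^p\lambda_j^{\downarrow}(A)\le\prod_{j=1}^p\lambda_j^{\downarrow}(B)$ for all $p=1,\ldots,d$. *)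

(* Defs.v *)
From mathcomp Require Import all_boot all_order all_algebra.
From mathcomp Require Export spectral sesquilinear complex.
From mathcomp Require Export reals.

Set Implicit Arguments.
Unset Strict Implicit.
Unset Printing Implicit Defensive.

Import Order.TTheory GRing.Theory Num.Theory.
Local Open Scope ring_scope.
Local Open Scope sesquilinear_scope.

(* Over a numClosedFieldType, [0 <= z] entails that [z] is real; [M ^t*] is the
   conjugate transpose of [M]. *)
Definition psdmx (C : numClosedFieldType) (d : nat) (A : 'M[C]_d) : Prop :=
  A \is hermsymmx /\ forall x : 'cV[C]_d, 0 <= (x ^t* *m A *m x) 0 0.

(* Spectral calculus: with A = P^-1 D P (P unitary, D diagonal), the matrix
   P^-1 D^(1/2) P. By sqrtmx_psd, sqrtmxK and sqrtmx_unique below, for A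
   positive semidefinite this is the unique positive semidefinite square root
   of A; the value on non-normal matrices is junk. *)
Definition sqrtmx (C : numClosedFieldType) (d : nat) (A : 'M[C]_d) : 'M[C]_d :=
  invmx (spectralmx A) *m diag_mx (map_mx sqrtC (spectral_diag A))
    *m spectralmx A.

Definition absmx (C : numClosedFieldType) (d : nat) (A : 'M[C]_d) : 'M[C]_d :=
  sqrtmx (A ^t* *m A).

Definition qsymmx (C : numClosedFieldType) (d : nat) (A : 'M[C]_d) : 'M[C]_d :=
  sqrtmx (2^-1 *: (absmx A *m absmx A + absmx (A ^t*) *m absmx (A ^t*))).

(* Roots of the characteristic polynomial, with multiplicity, in nonincreasing
   order. The order of C is only partial, so the sorting is meaningful when all
   eigenvalues are real, in particular for positive semidefinite A. *)
Definition eigs (C : numClosedFieldType) (d : nat) (A : 'M[C]_d) : seq C :=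
  sort (fun x y => y <= x) (sval (closed_field_poly_normal (char_poly A))).

Definition wlogmaj (C : numClosedFieldType) (d : nat) (A B : 'M[C]_d) : Prop :=
  forall p : nat, (1 <= p <= d)%N ->
    \prod_(j < p) (eigs A)`_j <= \prod_(j < p) (eigs B)`_j.

Lemma char_poly_eigs (C : numClosedFieldType) (d : nat) (A : 'M[C]_d) :
  char_poly A = \prod_(z <- eigs A) ('X - z%:P).
Proof.
rewrite /eigs; case: closed_field_poly_normal => r /= Dp.
rewrite {1}Dp (monicP (char_poly_monic A)) scale1r.
by apply/perm_big; rewrite perm_sym perm_sort.
Qed.

Lemma size_eigs (C : numClosedFieldType) (d : nat) (A : 'M[C]_d) :
  size (eigs A) = d.
Proof.
have := size_char_poly A; rewrite char_poly_eigs size_prod_XsubC.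
by case.
Qed.

Lemma adjmxM (C : numClosedFieldType) (m n p : nat)
    (A : 'M[C]_(m, n)) (B : 'M[C]_(n, p)) :
  (A *m B) ^t* = B ^t* *m A ^t*.
Proof. by rewrite trmx_mul map_mxM. Qed.

Lemma hermsymmxE (C : numClosedFieldType) (d : nat) (A : 'M[C]_d) :
  (A \is hermsymmx) = (A == A ^t*).
Proof. by rewrite qualifE /= expr0 scale1r. Qed.

Lemma normsq_cV (C : numClosedFieldType) (n : nat) (x : 'cV[C]_n) :
  (x ^t* *m x) 0 0 = \sum_i `|x i 0| ^+ 2.
Proof. by rewrite mxE; apply: eq_bigr => i _; rewrite !mxE mulrC -normCK. Qed.

Lemma psdmx_gram (C : numClosedFieldType) (m d : nat) (A : 'M[C]_(m, d)) :
  psdmx (A ^t* *m A).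
Proof.
split; first by rewrite hermsymmxE adjmxM trmxCK.
move=> x; rewrite mulmxA -adjmxM -mulmxA normsq_cV.
by apply: sumr_ge0 => i _; rewrite exprn_ge0.
Qed.

Lemma psdmxD (C : numClosedFieldType) (d : nat) (A B : 'M[C]_d) :
  psdmx A -> psdmx B -> psdmx (A + B).
Proof.
move=> [hA pA] [hB pB]; split.
  move: hA hB; rewrite !hermsymmxE => /eqP hA /eqP hB.
  by rewrite linearD map_mxD -hA -hB.
by move=> x; rewrite mulmxDr mulmxDl mxE addr_ge0.
Qed.

Lemma psdmxZ (C : numClosedFieldType) (d : nat) (a : C) (A : 'M[C]_d) :
  0 <= a -> psdmx A -> psdmx (a *: A).
Proof.
move=> a0 [hA pA]; split.
  move: hA; rewrite !hermsymmxE => /eqP hA.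
  by rewrite linearZ map_mxZ -hA /= geC0_conj.
by move=> x; rewrite -scalemxAr -scalemxAl mxE mulr_ge0.
Qed.

Lemma psdmx_sum (C : numClosedFieldType) (d m : nat) (F : 'I_m -> 'M[C]_d) :
  (forall k, psdmx (F k)) -> psdmx (\sum_k F k).
Proof.
move=> pF; apply: big_ind => // [|A B]; last exact: psdmxD.
split=> [|x]; last by rewrite mulmx0 mul0mx mxE.
by rewrite hermsymmxE trmx0 map_mx0.
Qed.

Lemma psdmx_eigen_ge0 (C : numClosedFieldType) (d : nat) (A : 'M[C]_d) (a : C) :
  psdmx A -> eigenvalue A a -> 0 <= a.
Proof.
move=> [hA pA] /eigenvalueP[v vA v0].
have := pA (v ^t*); rewrite trmxCK vA -scalemxAl mxE.
have -> : (v *m v ^t*) 0 0 = ((v ^t*) ^t* *m v ^t*) 0 0 by rewrite trmxCK.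
rewrite normsq_cV pmulr_lge0 // lt_def sumr_ge0 ?andbT => [|i _]; last first.
  by rewrite exprn_ge0.
apply: contra v0; rewrite psumr_eq0 => [/allP h|i _]; last by rewrite exprn_ge0.
apply/eqP/rowP => i; have := h i (mem_index_enum _).
by rewrite expf_eq0 /= normr_eq0 !mxE conjC_eq0 => /eqP.
Qed.

Lemma eigs_sorted (C : numClosedFieldType) (d : nat) (A : 'M[C]_d) :
  psdmx A -> sorted (fun x y => y <= x) (eigs A) /\ all (>= 0) (eigs A).
Proof.
move=> pA.
have ge0 : all (>= 0) (eigs A).
  apply/allP => a aA /=; apply: (psdmx_eigen_ge0 pA).
  by rewrite eigenvalue_root_char char_poly_eigs root_prod_XsubC.
split=> //; move: ge0; rewrite /eigs all_sort => ge0.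
apply: (sort_sorted_in (P := >= 0)) => // x y x0 y0.
exact: real_leVge (ger0_real y0) (ger0_real x0).
Qed.

Lemma psdmx_spectral (C : numClosedFieldType) (d : nat) (A : 'M[C]_d) :
  psdmx A -> A = invmx (spectralmx A) *m diag_mx (spectral_diag A)
                   *m spectralmx A.
Proof.
by move=> [/hermitian_normalmx hA _]; exact/orthomx_spectralP.
Qed.

Lemma spectral_diag_ge0 (C : numClosedFieldType) (d : nat) (A : 'M[C]_d) i :
  psdmx A -> 0 <= spectral_diag A 0 i.
Proof.
move=> pA; apply: (psdmx_eigen_ge0 pA); apply/eigenvalueP.
exists (row i (spectralmx A)).
  rewrite -row_mul {2}(psdmx_spectral pA) !mulmxA mulmxV ?spectral_unit //.
  by rewrite mul1mx row_mul row_diag_mx -scalemxAl -rowE.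
apply/eqP => r0; have := row_mul i (spectralmx A) (invmx (spectralmx A)).
rewrite r0 mul0mx mulmxV ?spectral_unit // => /rowP/(_ i)/eqP.
by rewrite !mxE eqxx oner_eq0.
Qed.

Lemma sqrtmxK (C : numClosedFieldType) (d : nat) (A : 'M[C]_d) :
  psdmx A -> sqrtmx A *m sqrtmx A = A.
Proof.
move=> pA; rewrite {3}(psdmx_spectral pA) /sqrtmx.
set P := spectralmx A; set D := diag_mx (map_mx _ _).
have -> : diag_mx (spectral_diag A) = D *m D.
  rewrite mulmx_diag; congr diag_mx; apply/rowP => i.
  by rewrite !mxE -expr2 sqrtCK.
by rewrite !mulmxA mulmxK ?spectral_unit.
Qed.

Lemma sqrtmx_psd (C : numClosedFieldType) (d : nat) (A : 'M[C]_d) :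
  psdmx A -> psdmx (sqrtmx A).
Proof.
move=> pA; rewrite /sqrtmx invmx_unitary ?spectral_unitarymx //.
set P := spectralmx A; set s := map_mx sqrtC _.
pose h := map_mx sqrtC s.
have hE : diag_mx s = (diag_mx h) ^t* *m diag_mx h.
  rewrite tr_diag_mx map_diag_mx mulmx_diag; congr diag_mx; apply/rowP => i.
  have h0 : 0 <= h 0 i by rewrite !mxE !sqrtC_ge0 spectral_diag_ge0.
  by rewrite !mxE /= geC0_conj; [rewrite -expr2 sqrtCK | move: h0; rewrite !mxE].
by rewrite hE !mulmxA -adjmxM -mulmxA; exact: psdmx_gram.
Qed.

Lemma sqrtmx_unique (C : numClosedFieldType) (d : nat) (A B : 'M[C]_d) :
  psdmx B -> B *m B = A -> sqrtmx A = B.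
Proof.
move=> pB BA.
have pA : psdmx A.
  case: (pB) => [hB _]; rewrite -BA; move: hB; rewrite hermsymmxE => /eqP hB.
  by rewrite {1}hB; exact: psdmx_gram.
set P := spectralmx A; set Q := spectralmx B.
pose t := spectral_diag B; pose s := map_mx sqrtC (spectral_diag A).
have uP : P \in unitmx by exact: spectral_unit.
have uQ : Q \in unitmx by exact: spectral_unit.
have BE : B = invmx Q *m diag_mx t *m Q by exact: psdmx_spectral.
have SE : sqrtmx A = invmx P *m diag_mx s *m P by [].
(* W intertwines the squares of two nonnegative diagonal matrices, hence the
   matrices themselves *)
have [W defW] : exists W, W = P *m invmx Q by exists (P *m invmx Q).
have W2 : diag_mx s *m diag_mx s *m W = W *m (diag_mx t *m diag_mx t).
  have E : sqrtmx A *m sqrtmx A = B *m B by rewrite BA sqrtmxK.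
  move: E; rewrite SE BE !mulmxA !mulmxK // => /(congr1 (fun X => P *m X *m invmx Q)).
  by rewrite defW !mulmxA !mulmxV // mul1mx mulmxK // => ->.
have W1 : diag_mx s *m W = W *m diag_mx t.
  apply/matrixP => i j; move/matrixP/(_ i j): W2.
  rewrite !mulmx_diag !mul_diag_mx !mul_mx_diag.
  rewrite !mxE.
  have [->|w0] := eqVneq (W i j) 0; first by rewrite !(mulr0, mul0r).
  rewrite mulrC => /(mulfI w0)/eqP; rewrite -!expr2 eqrXn2 ?sqrtC_ge0 ?spectral_diag_ge0 //.
  by move/eqP->; rewrite mulrC.
rewrite SE BE; have := congr1 (fun X => invmx P *m X *m Q) W1.
by rewrite defW !mulmxA mulVmx // mul1mx mulmxKV.
Qed.

Lemma absmx_psd (C : numClosedFieldType) (d : nat) (A : 'M[C]_d) :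
  psdmx (absmx A).
Proof. exact/sqrtmx_psd/psdmx_gram. Qed.

Lemma absmx_sqr (C : numClosedFieldType) (d : nat) (A : 'M[C]_d) :
  absmx A *m absmx A = A ^t* *m A.
Proof. exact/sqrtmxK/psdmx_gram. Qed.

Lemma absmx_adj_sqr (C : numClosedFieldType) (d : nat) (A : 'M[C]_d) :
  absmx (A ^t*) *m absmx (A ^t*) = A *m A ^t*.
Proof. by rewrite absmx_sqr trmxCK. Qed.

Lemma qsymmx_arg_psd (C : numClosedFieldType) (d : nat) (A : 'M[C]_d) :
  psdmx (2^-1 *: (absmx A *m absmx A + absmx (A ^t*) *m absmx (A ^t*))).
Proof.
apply: psdmxZ; first by rewrite invr_ge0.
by apply: psdmxD; rewrite absmx_sqr; exact: psdmx_gram.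
Qed.

Lemma qsymmx_psd (C : numClosedFieldType) (d : nat) (A : 'M[C]_d) :
  psdmx (qsymmx A).
Proof. exact/sqrtmx_psd/qsymmx_arg_psd. Qed.

(* Main.v *)
(* Put Z_k = sqrt 2 |A_k|_qsym, so that Z_k^2 = A_k^* A_k + A_k A_k^*. The square
   of diag(Z_k, Z_k) dominates that of the Hermitian dilation of A_k, so by
   operator monotonicity of the square root the block matrix
   [[Z_k, A_k], [A_k^*, Z_k]] is positive semidefinite. Summing over k, so is
   [[Z, S], [S^*, Z]] with Z = sum Z_k and S = sum A_k. Compressing it to the
   top p singular vectors of S on both sides yields [[P, D], [D, Q]] >= 0 with
   D = diag(s_1(S), ..., s_p(S)), whence (det D)^2 <= det P det Q, and both
   determinants are at most the product of the p largest eigenvalues of Z by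
   Cauchy interlacing. *)
Require Import Defs.
From mathcomp Require Import all_boot all_order all_algebra all_fingroup.

Set Implicit Arguments.
Unset Strict Implicit.
Unset Printing Implicit Defensive.

Import Order.TTheory GRing.Theory Num.Theory.
Local Open Scope ring_scope.

Section PsdMatrices.
Local Open Scope sesquilinear_scope.
Context (C : numClosedFieldType).

(** * Eigenvalues in sorted order and orthonormal eigenrows *)

Lemma char_poly_conj d (P D : 'M[C]_d) :
  P \in unitmx -> char_poly (invmx P *m D *m P) = char_poly D.
Proof.
move=> uP; rewrite /char_poly /char_poly_mx !map_mxM.
set Pc := map_mx polyC P; set Qc := map_mx polyC (invmx P).
have QP : Qc *m Pc = 1%:M.
  rewrite /Qc /Pc -map_mxM mulVmx //; exact: map_mx1.
have XE : 'X%:M = Qc *m 'X%:M *m Pc :> 'M_d.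
  by rewrite mul_mx_scalar -scalemxAl QP scalemx1.
by rewrite {1}XE -mulmxBl -mulmxBr !det_mulmx mulrAC -det_mulmx QP det1 mul1r.
Qed.

(** The spectral diagonal and [eigs A] both list the roots of the characteristic polynomial, so a
    permutation [s] matches them; [V] collects the rows of [spectralmx A] in that order, cut off
    after [p]. *)
Lemma eigs_frame p d (A : 'M[C]_d) : psdmx A -> (p <= d)%N ->
  exists2 V : 'M[C]_(p, d), V \is unitarymx &
    V *m A = diag_mx (\row_j (eigs A)`_j) *m V.
Proof.
move=> pA le_pd; set P := spectralmx A; set t := spectral_diag A.
have uP : P \is unitarymx by exact: spectral_unitarymx.
have EP : P *m A = diag_mx t *m P.
  by rewrite {1}(psdmx_spectral pA) -mulmxA mulKVmx ?spectral_unit.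
have /tuple_permP[s Es] : perm_eq (eigs A) [tuple t 0 i | i < d].
  apply: prod_XsubC_eq; rewrite -char_poly_eigs {1}(psdmx_spectral pA).
  rewrite char_poly_conj ?spectral_unit // char_poly_trig; last exact: diag_mx_is_trig.
  rewrite big_map big_enum /=; apply: eq_bigr => i _.
  by rewrite mxE eqxx.
pose f := s \o widen_ord le_pd.
have Ef (i : 'I_p) : (eigs A)`_i = t 0 (f i).
  have id := leq_trans (ltn_ord i) le_pd.
  rewrite Es /= (nth_map (widen_ord le_pd i)) ?size_enum_ord // tnth_mktuple.
  by rewrite /f /=; congr (t 0 (s _)); apply: val_inj; rewrite /= nth_enum_ord.
exists (rowsub f P).
  apply/unitarymxP/matrixP => i j; rewrite mxE.
  have /unitarymxP/matrixP/(_ (f i) (f j)) := uP.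
  rewrite !mxE (inj_eq perm_inj) -val_eqE /= => <-.
  by apply: eq_bigr => k _; rewrite !mxE.
apply/matrixP => i j; transitivity ((P *m A) (f i) j).
  by rewrite !mxE; apply: eq_bigr => k _; rewrite mxE.
by rewrite EP !mul_diag_mx !mxE Ef.
Qed.

Lemma eigs_noninc d (A : 'M[C]_d) i j : psdmx A -> (i <= j < d)%N ->
  (eigs A)`_j <= (eigs A)`_i.
Proof.
move=> /eigs_sorted[sA _] /andP[ij jd].
apply: (@sorted_leq_nth _ (fun x y : C => y <= x)) => //; rewrite ?inE ?size_eigs //.
  by move=> x y z /[swap]; apply: le_trans.
exact: leq_ltn_trans jd.
Qed.

Lemma eigs_ge0 d (A : 'M[C]_d) i : psdmx A -> 0 <= (eigs A)`_i.
Proof.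
move=> /eigs_sorted[_ /allP A0]; case: (ltnP i (size (eigs A))) => [id|/(nth_default 0)-> //].
exact/A0/mem_nth.
Qed.

(** * Eigenvalues and determinants of compressions *)

Lemma form_diag n (t x : 'rV[C]_n) :
  (x *m diag_mx t *m x ^t*) 0 0 = \sum_i t 0 i * `|x 0 i| ^+ 2.
Proof.
rewrite mul_mx_diag mxE; apply: eq_bigr => i _; rewrite !mxE mulrAC mulrC.
by rewrite normCK.
Qed.

Lemma normsq_rV n (x : 'rV[C]_n) : (x *m x ^t*) 0 0 = \sum_i `|x 0 i| ^+ 2.
Proof. by rewrite mxE; apply: eq_bigr => i _; rewrite !mxE normCK. Qed.

Lemma normsq_rV_gt0 n (x : 'rV[C]_n) : x != 0 -> 0 < (x *m x ^t*) 0 0.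
Proof.
move=> x0; rewrite normsq_rV lt_def sumr_ge0 ?andbT => [|i _]; last exact: exprn_ge0.
apply: contra x0; rewrite psumr_eq0 => [/allP h|i _]; last exact: exprn_ge0.
apply/eqP/rowP => i; have := h i (mem_index_enum _).
by rewrite expf_eq0 /= normr_eq0 mxE => /eqP.
Qed.

Lemma psdmx_form d (A : 'M[C]_d) (x : 'rV[C]_d) :
  psdmx A -> 0 <= (x *m A *m x ^t*) 0 0.
Proof. by case=> _ /(_ (x ^t*)); rewrite trmxCK. Qed.

(* Courant-Fischer: the span of the first [j + 1] eigenrows of [A], carried to
   dimension [d] by [V], meets the span of the eigenrows of [B] of index at
   least [j]. *)
Lemma eigs_le_compress p d (A : 'M[C]_p) (B : 'M[C]_d) (V : 'M[C]_(p, d)) j :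
  psdmx A -> psdmx B -> V \is unitarymx ->
  (forall x : 'rV[C]_p,
     (x *m A *m x ^t*) 0 0 <= (x *m (V *m B *m V ^t*) *m x ^t*) 0 0) ->
  (j < p)%N -> (eigs A)`_j <= (eigs B)`_j.
Proof.
move=> pA pB uV leAB jp.
have pd : (p <= d)%N by rewrite -(mxrank_unitary uV) rank_leq_col.
have jd := leq_trans jp pd.
have [T uT ET] := eigs_frame pA jp.
have [U uU EU] := eigs_frame pB (leqnn d).
have UU : U ^t* *m U = 1%:M by rewrite -invmx_unitary // mulVmx // unitarymx_unit.
pose M := T *m V *m U ^t*; pose N := colsub (widen_ord (ltnW jd)) M.
(* [N] has [j + 1] rows and only [j] columns, so its left kernel is nonzero. *)
have /rowV0Pn[x /sub_kermxP xN x0] : kermx N != 0.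
  by rewrite kermx_eq0 /row_free ltn_eqF // ltnS rank_leq_col.
have [w wE] : exists w, w = x *m M by exists (x *m M).
have w0 (i : 'I_d) : (i < j)%N -> w 0 i = 0.
  move=> ij; transitivity ((x *m N) 0 (Ordinal ij)); last by rewrite xN mxE.
  rewrite wE !mxE; apply: eq_bigr => k _; rewrite [N _ _]mxE; congr (_ * M _ _).
  exact: val_inj.
have wU : w *m U = x *m T *m V by rewrite wE /M -!mulmxA UU mulmx1.
have ww : w *m w ^t* = x *m x ^t*.
  rewrite [LHS](_ : _ = (w *m U) *m (w *m U) ^t*); last first.
    by rewrite adjmxM mulmxA -(mulmxA w) (unitarymxP uU) mulmx1.
  rewrite wU !adjmxM !mulmxA -(mulmxA (x *m T)) (unitarymxP uV) mulmx1.
  by rewrite -(mulmxA x) (unitarymxP uT) mulmx1.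
have := leAB (x *m T).
have -> : x *m T *m (V *m B *m V ^t*) *m (x *m T) ^t* =
          w *m diag_mx (\row_j (eigs B)`_j) *m w ^t*.
  rewrite !mulmxA -mulmxA -adjmxM -wU adjmxM -(mulmxA w) EU.
  by rewrite !mulmxA -(mulmxA _ U) (unitarymxP uU) mulmx1.
have -> : x *m T *m A *m (x *m T) ^t* = x *m diag_mx (\row_j (eigs A)`_j) *m x ^t*.
  by rewrite -(mulmxA x) ET adjmxM !mulmxA -(mulmxA _ T) (unitarymxP uT) mulmx1.
rewrite !form_diag => le_sum.
(* Rayleigh bounds: [x] only involves eigenvalues of [A] of index at most [j], and [w], of the same
   norm, only those of [B] of index at least [j]. *)
have lowA : (eigs A)`_j * (x *m x ^t*) 0 0 <= \sum_i (\row_j (eigs A)`_j) 0 i * `|x 0 i| ^+ 2.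
  rewrite normsq_rV mulr_sumr; apply: ler_sum => i _; rewrite mxE.
  by rewrite ler_wpM2r ?exprn_ge0 // eigs_noninc // -ltnS ltn_ord.
have upB : \sum_i (\row_j (eigs B)`_j) 0 i * `|w 0 i| ^+ 2 <= (eigs B)`_j * (x *m x ^t*) 0 0.
  rewrite -ww normsq_rV mulr_sumr; apply: ler_sum => i _; rewrite mxE.
  have [/w0->|ji] := ltnP i j; first by rewrite normr0 expr0n /= !mulr0.
  by rewrite ler_wpM2r ?exprn_ge0 // eigs_noninc // ji ltn_ord.
by rewrite -(ler_pM2r (normsq_rV_gt0 x0)) (le_trans lowA) // (le_trans le_sum).
Qed.

Lemma det_eigs d (A : 'M[C]_d) : psdmx A -> \det A = \prod_(j < d) (eigs A)`_j.
Proof.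
move=> pA; have [U uU EU] := eigs_frame pA (leqnn d).
have dU : \det U != 0 by rewrite -unitfE -unitmxE unitarymx_unit.
apply: (mulfI dU); rewrite -det_mulmx EU det_mulmx det_diag mulrC; congr (_ * _).
by apply: eq_bigr => j _; rewrite mxE.
Qed.

(** The eigenvalues of the compression are nonnegative and bounded index by index by those of
    [B]. *)
Lemma det_compress p d (B : 'M[C]_d) (V : 'M[C]_(p, d)) :
  psdmx B -> V \is unitarymx -> psdmx (V *m B *m V ^t*) ->
  0 <= \det (V *m B *m V ^t*) <= \prod_(j < p) (eigs B)`_j.
Proof.
move=> pB uV pV; rewrite det_eigs // prodr_ge0 /= => [|j _]; last exact: eigs_ge0.
apply: ler_prod => j _; rewrite eigs_ge0 //=.
exact: (eigs_le_compress (V := V)).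
Qed.

Lemma det_mono p (A B : 'M[C]_p) : psdmx A -> psdmx B ->
  (forall x : 'rV[C]_p, (x *m A *m x ^t*) 0 0 <= (x *m B *m x ^t*) 0 0) ->
  \det A <= \det B.
Proof.
move=> pA pB leAB; rewrite !det_eigs //; apply: ler_prod => j _; rewrite eigs_ge0 //=.
have u1 : (1%:M : 'M[C]_p) \is unitarymx by apply/unitarymxP; rewrite trmx1 map_mx1 mulmx1.
by apply: (eigs_le_compress (V := 1%:M)) => // x; rewrite trmx1 map_mx1 mulmx1 mul1mx.
Qed.

(** * Monotonicity of the square root and positive block matrices *)

Lemma hermsym_psd d (A : 'M[C]_d) :
  A \is hermsymmx -> (forall i, 0 <= spectral_diag A 0 i) -> psdmx A.
Proof.
move=> hA A0; split=> // x.
have /orthomx_spectralP-> := hermitian_normalmx hA.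
rewrite invmx_unitary ?spectral_unitarymx //.
have := form_diag (spectral_diag A) (x ^t* *m (spectralmx A) ^t*).
rewrite adjmxM !trmxCK !mulmxA => ->.
by apply: sumr_ge0 => i _; rewrite mulr_ge0 ?exprn_ge0.
Qed.

Lemma psdmx_compress p d (B : 'M[C]_d) (V : 'M[C]_(p, d)) :
  psdmx B -> psdmx (V *m B *m V ^t*).
Proof.
case; rewrite hermsymmxE => /eqP hB pB; split.
  by rewrite hermsymmxE !adjmxM trmxCK -hB mulmxA.
by move=> x; have := pB (V ^t* *m x); rewrite adjmxM trmxCK !mulmxA.
Qed.

(* If [r (T - H) = m r] with [|r| = 1], then [r (T^2 - H^2) r^*] equals
   [m (2 r T r^* - m)], which is negative when [m < 0]. *)
Lemma psdmx_sub_of_sqr d (T H : 'M[C]_d) : psdmx T -> H \is hermsymmx ->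
  psdmx (T *m T - H *m H) -> psdmx (T - H).
Proof.
move=> pT hH pTH; have [hT _] := pT; set M := T - H.
have hM : M \is hermsymmx.
  move: hT hH; rewrite !hermsymmxE => /eqP hT /eqP hH.
  by rewrite /M linearB /= map_mxB -hT -hH.
apply: hermsym_psd => // i; set m := spectral_diag M 0 i.
have mR : m \is Num.real by have /mxOverP := hermitian_spectral_diag_real hM; apply.
pose r := row i (spectralmx M).
have rM : r *m M = m *: r.
  rewrite /r -row_mul {2}(orthomx_spectralP (hermitian_normalmx hM)).
  rewrite -mulmxA mulKVmx ?spectral_unit // row_mul row_diag_mx.
  by rewrite -scalemxAl -rowE.
have Mr : M *m r ^t* = m *: r ^t*.
  have /(congr1 (fun X => X ^t*)) := rM; rewrite adjmxM linearZ map_mxZ /=.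
  by move: hM; rewrite hermsymmxE => /eqP <-; rewrite conj_Creal.
have rr : (r *m r ^t*) 0 0 = 1.
  have /unitarymxP/matrixP/(_ i i) := spectral_unitarymx M; rewrite !mxE eqxx mulr1n => <-.
  by apply: eq_bigr => k _; rewrite !mxE.
have rHr : (r *m H *m r ^t*) 0 0 = (r *m T *m r ^t*) 0 0 - m.
  have -> : H = T - M by rewrite /M opprB addrC subrK.
  by rewrite mulmxBr mulmxBl rM -scalemxAl !mxE /= -[in RHS](mulr1 m) -rr !mxE.
have := psdmx_form r pTH.
(* This factorization needs no commutation, and each term has [M] next to an eigenvector [r]. *)
have -> : T *m T - H *m H = T *m M + M *m H.
  by rewrite /M mulmxBr mulmxBl addrA subrK.
rewrite mulmxDr mulmxDl !mulmxA rM -(mulmxA (r *m T)) Mr -scalemxAr -!scalemxAl.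
rewrite mxE [X in X + _]mxE [X in _ + X]mxE rHr -mulrDr.
set a := (r *m T *m _) 0 0; have a0 : 0 <= a by exact: psdmx_form.
move=> ma; case/real_ge0P: mR => // m0.
move: ma; rewrite nmulr_rge0 // => /le_gtF <-.
by rewrite ltr_wpDl // ltr_wpDl // oppr_gt0.
Qed.

(* Apply [psdmx_sub_of_sqr] to [T = diag(Z, Z)] and the Hermitian dilation of
   [- A], whose square is [diag(A A^*, A^* A)]. *)
Lemma block_psd d (Z A : 'M[C]_d) : psdmx Z ->
  Z *m Z = A ^t* *m A + A *m A ^t* -> psdmx (block_mx Z A (A ^t*) Z).
Proof.
move=> pZ ZZ.
have -> : block_mx Z A (A ^t*) Z = block_mx Z 0 0 Z - block_mx 0 (- A) (- A ^t*) 0.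
  by rewrite opp_block_mx add_block_mx !oppr0 !opprK !addr0 !add0r.
apply: psdmx_sub_of_sqr.
- pose q := sqrtmx Z.
  have : psdmx ((block_mx q 0 0 q) ^t* *m block_mx q 0 0 q) by exact: psdmx_gram.
  have qq : q ^t* = q.
    by have [] := sqrtmx_psd pZ; rewrite hermsymmxE => /eqP <-.
  rewrite tr_block_mx map_block_mx !trmx0 !map_mx0 qq mulmx_block.
  by rewrite !mulmx0 !mul0mx !addr0 !add0r sqrtmxK.
- rewrite hermsymmxE tr_block_mx map_block_mx !trmx0 !map_mx0 !linearN /= !map_mxN.
  by rewrite trmxCK.
rewrite !mulmx_block !mulmx0 !mul0mx !addr0 !add0r !mulmxN !mulNmx !opprK ZZ.
rewrite opp_block_mx add_block_mx !oppr0 !addr0 addrK [A ^t* *m A + _]addrC addrK.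
have := psdmx_gram (block_mx A 0 0 (A ^t*)).
rewrite tr_block_mx map_block_mx !trmx0 !map_mx0 trmxCK mulmx_block.
by rewrite !mulmx0 !mul0mx !addr0 !add0r.
Qed.

Lemma block_psd_sum d m (Z A : 'I_m -> 'M[C]_d) :
  (forall k, psdmx (block_mx (Z k) (A k) ((A k) ^t*) (Z k))) ->
  psdmx (block_mx (\sum_k Z k) (\sum_k A k) ((\sum_k A k) ^t*) (\sum_k Z k)).
Proof.
move=> pZA.
apply: (big_ind2 (fun Z A => psdmx (block_mx Z A (A ^t*) Z))) => // [|Z1 A1 Z2 A2 p1 p2].
  split=> [|x]; first by rewrite hermsymmxE trmx0 map_mx0 block_mx0 trmx0 map_mx0 eqxx.
  by rewrite trmx0 map_mx0 block_mx0 mulmx0 mul0mx mxE.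
by rewrite linearD map_mxD -add_block_mx; apply: psdmxD.
Qed.

(** * Determinant inequality for positive blocks *)

Lemma block_form d (P D Q : 'M[C]_d) (x y : 'rV[C]_d) :
  psdmx (block_mx P D (D ^t*) Q) ->
  0 <= (x *m P *m x ^t*) 0 0 + (x *m D *m y ^t*) 0 0
       + ((y *m D ^t* *m x ^t*) 0 0 + (y *m Q *m y ^t*) 0 0).
Proof.
move=> /(psdmx_form (row_mx x y)); rewrite tr_row_mx map_col_mx mul_row_block.
by rewrite mul_row_col !mulmxDl mxE [X in X + _]mxE [X in _ + X]mxE addrACA.
Qed.

Lemma det_adj d (D : 'M[C]_d) : \det (D ^t*) = (\det D)^*.
Proof. by rewrite det_map_mx det_tr. Qed.

(* If [x P = 0], the form at [(- t x, x D)] is [q - 2 t |x D|^2] with [q] fixed,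
   so letting [t] grow forces [x D = 0]. *)
Lemma block_unit d (P D Q : 'M[C]_d) : D \in unitmx ->
  psdmx (block_mx P D (D ^t*) Q) -> P \in unitmx.
Proof.
move=> uD pB; apply/negPn/negP; rewrite -row_free_unit -kermx_eq0.
case/rowV0Pn=> x /sub_kermxP xP x0; pose z := x *m D.
have z0 : z != 0.
  by apply: contra x0 => /eqP z0; rewrite -(mulmxK uD x) -/z z0 mul0mx.
have zz := normsq_rV_gt0 z0; set n := (z *m z ^t*) 0 0 in zz.
have zx : z *m D ^t* *m x ^t* = z *m z ^t* by rewrite /z adjmxM !mulmxA.
set q := (z *m Q *m z ^t*) 0 0.
have form_at t : 0 <= t -> 0 <= q - (t * n) *+ 2.
  move=> t0; have := block_form (- t *: x) z pB.
  have -> : (- t *: x) ^t* = - t *: x ^t*.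
    by rewrite linearZ map_mxZ /= conj_Creal // rpredN ger0_real.
  rewrite -!scalemxAl xP mul0mx scaler0 -!scalemxAr zx -/z mxE add0r.
  by rewrite [X in X + _]mxE [X in _ + (X + _)]mxE -/n -/q addrA addrC !mulNr mulr2n opprD.
have q0 : 0 <= q by have := form_at 0 (lexx _); rewrite mul0r mul0rn subr0.
(* For this [t] the form equals [q - 2 (q + 1) = - q - 2], which is negative. *)
have := form_at ((q + 1) / n) (divr_ge0 (addr_ge0 q0 ler01) (ltW zz)).
rewrite divfK ?gt_eqF // subr_ge0 mulr2n => /le_gtF.
by rewrite -addrA ltrDl ltr_pwDl // addr_ge0.
Qed.

(* The Schur complement [Q - D^* P^-1 D] is positive semidefinite. *)
Lemma block_det d (P D Q : 'M[C]_d) : D \in unitmx -> psdmx P -> psdmx Q ->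
  psdmx (block_mx P D (D ^t*) Q) -> `|\det D| ^+ 2 <= \det P * \det Q.
Proof.
move=> uD pP pQ pB; have uP := block_unit uD pB.
have [/[!hermsymmxE]/eqP hP _] := pP.
have hIP : (invmx P) ^t* = invmx P by rewrite trmx_inv map_invmx -hP.
pose E := D ^t* *m invmx P *m D.
have pE : psdmx E.
  have -> : E = (D ^t* *m invmx P) *m P *m (D ^t* *m invmx P) ^t*.
    by rewrite adjmxM trmxCK hIP mulmxKV // mulmxA.
  exact: psdmx_compress.
have leEQ : \det E <= \det Q.
  (* Since [v P = y D^*], at [(- v, y)] the term [v P v^*] cancels one cross term, and
     [y (Q - E) y^*] remains. *)
  apply: det_mono => // y; pose v := y *m D ^t* *m invmx P.
  have := block_form (- v) y pB; rewrite linearN /= map_mxN.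
  rewrite !mulNmx !mulmxN opprK mulmxKV //.
  set a := (_ *m v ^t*) 0 0; rewrite [X in _ + (X + _)]mxE -/a addrACA.
  by rewrite subrr add0r [X in X + _]mxE addrC /E !mulmxA subr_ge0.
have dP : 0 < \det P.
  rewrite lt_def -unitfE -unitmxE uP det_eigs // prodr_ge0 // => j _.
  exact: eigs_ge0.
apply: le_trans (ler_wpM2l (ltW dP) leEQ).
by rewrite !det_mulmx det_adj det_inv mulrAC [_^* * _]mulrC -normCK mulrC divfK ?gt_eqF.
Qed.

(** * Compression to singular vectors and conclusion *)

Lemma wlogmaj_block d (Z S : 'M[C]_d) :
  psdmx Z -> psdmx (block_mx Z S (S ^t*) Z) -> wlogmaj (absmx S) Z.
Proof.
move=> pZ pB p /andP[_ pd]; have pS := absmx_psd S; set s := eigs (absmx S).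
have Z0 : 0 <= \prod_(j < p) (eigs Z)`_j.
  by apply: prodr_ge0 => j _; exact: eigs_ge0.
(* A zero product is trivially dominated; otherwise [D] below is invertible. *)
have [-> //|s0] := eqVneq (\prod_(j < p) s`_j) 0.
have [V uV EV] := eigs_frame pS pd.
set D := diag_mx _ in EV.
have dD : \det D = \prod_(j < p) s`_j.
  by rewrite det_diag; apply: eq_bigr => j _; rewrite mxE.
have uD : D \in unitmx by rewrite unitmxE dD unitfE.
have hD : D ^t* = D.
  rewrite tr_diag_mx map_diag_mx; congr diag_mx; apply/rowP => j.
  by rewrite !mxE /= conj_Creal // ger0_real // eigs_ge0.
have hID : (invmx D) ^t* = invmx D by rewrite trmx_inv map_invmx hD.
have VSSV : V *m S ^t* *m S *m V ^t* = D *m D.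
  rewrite -(mulmxA V) -absmx_sqr mulmxA EV -(mulmxA D V) EV.
  by rewrite -!mulmxA (unitarymxP uV) mulmx1.
(* The rows of [V] give right singular vectors of [S], those of [W] the matching left ones:
   [V S^* S V^* = D^2] yields [W S V^* = D] and [W W^* = 1]. *)
have [W defW] : exists W, W = invmx D *m V *m S ^t*
  by exists (invmx D *m V *m S ^t*).
have WS : W *m S *m V ^t* = D.
  by rewrite defW -!mulmxA (mulmxA V) (mulmxA _ S) VSSV mulKmx.
have uW : W \is unitarymx.
  apply/unitarymxP; by rewrite [in X in X ^t*]defW !adjmxM trmxCK hID !mulmxA WS mulmxV.
have pW := psdmx_compress W pZ; have pV := psdmx_compress V pZ.
have pK : psdmx (block_mx (W *m Z *m W ^t*) D (D ^t*) (V *m Z *m V ^t*)).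
  have := psdmx_compress (block_mx W 0 0 V) pB.
  rewrite tr_block_mx map_block_mx !trmx0 !map_mx0 !mulmx_block.
  rewrite ?(mulmx0, mul0mx, addr0, add0r) WS.
  by rewrite (_ : V *m S ^t* *m W ^t* = D ^t*) // -WS !adjmxM trmxCK mulmxA.
have /andP[w0 wZ] := det_compress pZ uW pW.
have /andP[v0 vZ] := det_compress pZ uV pV.
have := block_det uD pW pV pK.
have s_ge0 : 0 <= \prod_(j < p) s`_j by apply: prodr_ge0 => j _; exact: eigs_ge0.
rewrite dD ger0_norm // => /le_trans/(_ (ler_pM w0 v0 wZ vZ)).
by rewrite -expr2 ler_sqr.
Qed.

(** The factor [sqrtC 2] absorbs the mean's [2^-1], giving exactly the hypothesis of [block_psd]. *)
Lemma qsymmx_sqr d (A : 'M[C]_d) :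
  (sqrtC 2 *: qsymmx A) *m (sqrtC 2 *: qsymmx A) = A ^t* *m A + A *m A ^t*.
Proof.
rewrite -scalemxAl -scalemxAr scalerA -expr2 sqrtCK sqrtmxK; last exact: qsymmx_arg_psd.
by rewrite scalerA mulfV ?pnatr_eq0 // scale1r absmx_sqr absmx_adj_sqr.
Qed.

End PsdMatrices.

Local Open Scope complex_scope.

Theorem corollary2p5 (R : realType) (d m : nat) (hd : (1 <= d)%N)
    (hm : (1 <= m)%N) (A : 'I_m -> 'M[R[i]]_d) :
  wlogmaj (absmx (\sum_(k < m) A k))
          (sqrtC 2 *: \sum_(k < m) qsymmx (A k)).
Proof.
have pZ k : psdmx (sqrtC 2 *: qsymmx (A k)).
  by apply: psdmxZ (qsymmx_psd _); rewrite sqrtC_ge0 ler0n.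
rewrite scaler_sumr; apply: wlogmaj_block; first exact: psdmx_sum.
by apply: block_psd_sum => k; apply: block_psd => //; apply: qsymmx_sqr.
Qed.
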